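(* Let $\mathfrak{M}\subseteq\mathbb{R}^n$ be a nonempty closed set and let $\ell\in C(\mathbb{R}^n)$ be bounded, with $\ell(x)>0$ for $x\in\mathbb{R}^n\setminus\mathfrak{M}$ and $\ell\equiv0$ on $\mathfrak{M}$. Assume that for all $\delta>0$ there exists $\gamma(\delta)>0$ such that $$\inf\{\ell(x):\ \mathrm{dist}(x,\mathfrak{M})>\delta\}>\gamma(\delta).$$ Let $v(x)=\inf_\alpha\int_0^{t_x(\alpha)}\ell(y_x^\alpha(s))\,ds$, and consider the optimal trajectories $y_x^{\alpha^*}(\cdot)$, i.e. the trajectories satisfying $\dot y(s)\in\{-p/|p|: p\in D^-v(y(s))\}$ for a.e. $s\in(0,t_x(\alpha^* ))$. Then, with respect to these trajectories: (i) $\mathfrak{M}$ is Lyapunov stable: for all $\varepsilon>0$ there exists $\eta>0$ such that $\mathrm{dist}(x,\mathfrak{M})\le\eta$ implies $\mathrm{dist}(y_x^{\alpha^*}(t),\mathfrak{M})\le\varepsilon$ for all $t\ge0$; (ii) $\mathfrak{M}$ is globally asymptotically stable: $\mathfrak{M}$ is Lyapunov stable and $\lim_{t\to+\infty}\mathrm{dist}(y_x^{\alpha^*}(t),\mathfrak{M})=0$ for all $x\in\mathbb{R}^n$.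
   Context: An admissible control is a measurable function $\alpha:[0,+\infty)\to B(0,1)$, where $B(0,1)$ is the closed unit ball of $\mathbb{R}^n$. Its trajectory from $x$ is $y_x^\alpha(t)=x+\int_0^t\alpha(s)\,ds$, and its hitting time is $t_x(\alpha)=\inf\{s\ge0: y_x^\alpha(s)\in\mathfrak{M}\}\in[0,+\infty]$. The infimum defining $v(x)$ is over admissible controls; $\alpha^*$ is optimal for $x$ if $\int_0^{t_x(\alpha^* )}\ell(y_x^{\alpha^*}(s))\,ds=v(x)$, and this is equivalent to its trajectory satisfying the differential inclusion in the claim. Convention: if $t_x(\alpha^* )<\infty$, an optimal trajectory is understood to remain in $\mathfrak{M}$ for $s\ge t_x(\alpha^* )$, so that $\ell(y_x^{\alpha^*}(s))=0$ for all $s\ge t_x(\alpha^* )$. The subdifferential of a continuous function $v$ at $z$ is $D^-v(z)=\{p\in\mathbb{R}^n:\liminf_{x\to z}\frac{v(x)-v(z)-p\cdot(x-z)}{|x-z|}\ge0\}$. *)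

(* Defs.v *)
From HB Require Import structures.
From mathcomp Require Import all_boot all_order all_algebra.
From mathcomp Require Import all_classical all_reals all_analysis.

Set Implicit Arguments.
Unset Strict Implicit.
Unset Printing Implicit Defensive.

Import Order.TTheory GRing.Theory Num.Theory.
Import numFieldNormedType.Exports.
Local Open Scope classical_set_scope.
Local Open Scope ring_scope.

(* R^n is 'rV[R]_n. Its library norm is the max norm; distances, the unit ball
   and p / |p| below use the Euclidean norm, which induces the same topology. *)
Definition enorm (R : realType) (n : nat) (x : 'rV[R]_n) : R :=
  Num.sqrt (\sum_i x ord0 i ^+ 2).

Definition dotp (R : realType) (n : nat) (x y : 'rV[R]_n) : R :=
  \sum_i x ord0 i * y ord0 i.

Definition dist (R : realType) (n : nat) (x : 'rV[R]_n) (M : set 'rV[R]_n) : R :=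
  inf [set enorm (x - z) | z in M].

(* Measurability of an R^n-valued function is measurability of its
   coordinates; values at negative times are irrelevant. *)
Definition admissible (R : realType) (n : nat) (a : R -> 'rV[R]_n) : Prop :=
  (forall i, measurable_fun (`[0, +oo[ : set R) (fun s : R => a s ord0 i)) /\
  (forall s : R, 0 <= s -> enorm (a s) <= 1).

Definition trajectory (R : realType) (n : nat) (x : 'rV[R]_n)
    (a : R -> 'rV[R]_n) (t : R) : 'rV[R]_n :=
  \row_i (x ord0 i + \int[lebesgue_measure]_(s in `[0, t]) (a s ord0 i)).

(* ereal_inf set0 = +oo: the hitting time is +oo if M is never reached. *)
Definition hitting_time (R : realType) (n : nat) (M : set 'rV[R]_n)
    (x : 'rV[R]_n) (a : R -> 'rV[R]_n) : \bar R :=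
  ereal_inf [set s%:E | s in [set s : R | 0 <= s /\ M (trajectory x a s)]].

Definition cost (R : realType) (n : nat) (M : set 'rV[R]_n)
    (l : 'rV[R]_n -> R) (x : 'rV[R]_n) (a : R -> 'rV[R]_n) : \bar R :=
  (\int[lebesgue_measure]_(s in [set s : R | (0 <= s)%R /\
     (s%:E < hitting_time M x a)%E]) (l (trajectory x a s))%:E)%E.

Definition evalue (R : realType) (n : nat) (M : set 'rV[R]_n)
    (l : 'rV[R]_n -> R) (x : 'rV[R]_n) : \bar R :=
  ereal_inf [set cost M l x a | a in [set a | admissible a]].

(* evalue is finite when M is nonempty and l is bounded and nonnegative
   (go straight to a point of M), so fine loses nothing. *)
Definition value (R : realType) (n : nat) (M : set 'rV[R]_n)
    (l : 'rV[R]_n -> R) (x : 'rV[R]_n) : R := fine (evalue M l x).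

Definition subdifferential (R : realType) (n : nat) (v : 'rV[R]_n -> R)
    (z : 'rV[R]_n) : set 'rV[R]_n :=
  [set p | (0 <= limf_einf
    (fun x => ((v x - v z - dotp p (x - z)) / enorm (x - z))%:E) z^')%E].

Definition optimal_cost (R : realType) (n : nat) (M : set 'rV[R]_n)
    (l : 'rV[R]_n -> R) (x : 'rV[R]_n) (a : R -> 'rV[R]_n) : Prop :=
  cost M l x a = evalue M l x.

(* p != 0 is what makes p / |p| meaningful (in Rocq 0^-1 = 0). *)
Definition optimal_inclusion (R : realType) (n : nat) (M : set 'rV[R]_n)
    (l : 'rV[R]_n -> R) (x : 'rV[R]_n) (a : R -> 'rV[R]_n) : Prop :=
  {ae lebesgue_measure, forall s : R,
    0 < s -> (s%:E < hitting_time M x a)%E ->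
    exists p : 'rV[R]_n,
      [/\ subdifferential (value M l) (trajectory x a s) p, p != 0 &
          is_derive (s : R) 1 (trajectory x a) (- ((enorm p)^-1 *: p))]}.

(* The two descriptions of optimality are equivalent when M and l satisfy the
   standing assumptions; trajectories given by either of them are included.
   The last clause is the convention that the trajectory stays in M once it
   has reached it: neither description constrains the control after the
   hitting time. *)
Definition optimal_trajectories (R : realType) (n : nat) (M : set 'rV[R]_n)
    (l : 'rV[R]_n -> R) (x : 'rV[R]_n) : set (R -> 'rV[R]_n) :=
  [set y | exists a : R -> 'rV[R]_n,
    [/\ admissible a,
        y = trajectory x a,
        optimal_cost M l x a \/ optimal_inclusion M l x a &
        forall s : R, 0 <= s -> (hitting_time M x a <= s%:E)%E -> M (y s)]].

(* Stability of M with respect to a family Y of trajectories, Y x being the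
   set of those that start at x. *)
Definition lyapunov_stable (R : realType) (n : nat) (M : set 'rV[R]_n)
    (Y : 'rV[R]_n -> set (R -> 'rV[R]_n)) : Prop :=
  forall eps : R, 0 < eps -> exists2 eta : R, 0 < eta &
    forall x : 'rV[R]_n, dist x M <= eta ->
    forall y, Y x y -> forall t : R, 0 <= t -> dist (y t) M <= eps.

Definition globally_asymptotically_stable (R : realType) (n : nat)
    (M : set 'rV[R]_n) (Y : 'rV[R]_n -> set (R -> 'rV[R]_n)) : Prop :=
  lyapunov_stable M Y /\
  forall (x : 'rV[R]_n) y, Y x y -> dist (y t) M @[t --> +oo] --> (0 : R).

(* Main.v *)
(* Write y for a trajectory from x, v for the value function and L(t) for the
   running cost up to time t. Everything rests on the bound L(t) <= v(x) before
   the hitting time. It is immediate when y is optimal for the cost. When y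
   solves the differential inclusion, it is the monotonicity of v(y(t)) + L(t):
   v is Lipschitz and satisfies |p| >= l for p in D^-v outside M (dynamic
   programming), so at almost every time the left difference quotient of
   v(y(t)) + L(t) is nonpositive in the limit, and a Lipschitz function with this
   property is nonincreasing.
   Since y has speed at most 1, being at distance more than eps from M at a time
   t >= eps/2 costs at least a fixed c(eps) > 0 over [t - eps/2, t]. Near M,
   v(x) <= C dist(x, M) cannot pay for one such excursion; from an arbitrary x,
   v(x) < oo cannot pay for infinitely many. *)

Require Import Defs.
From HB Require Import structures.
From mathcomp Require Import all_boot all_order all_algebra.
From mathcomp Require Import all_classical all_reals all_analysis.
From mathcomp Require Import measurable_realfun ring lra.

Import Order.TTheory GRing.Theory Num.Theory.
Import numFieldNormedType.Exports.
Local Open Scope classical_set_scope.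
Local Open Scope ring_scope.

(** * Euclidean norm, inner product and distance to a set *)

Section Euclidean.
Context {R : realType} {n : nat}.
Implicit Types (u v w x : 'rV[R]_n) (c : R) (M : set 'rV[R]_n).

Lemma enorm_ge0 u : 0 <= enorm u.
Proof. exact: sqrtr_ge0. Qed.

Lemma dotpuu u : dotp u u = enorm u ^+ 2.
Proof. by rewrite sqr_sqrtr ?sumr_ge0// => i _; exact: sqr_ge0. Qed.

Lemma dotpDl u v w : dotp (u + v) w = dotp u w + dotp v w.
Proof.
by rewrite /dotp -big_split /=; apply: eq_bigr => i _; rewrite mxE mulrDl.
Qed.

Lemma dotpDr u v w : dotp w (u + v) = dotp w u + dotp w v.
Proof.
by rewrite /dotp -big_split /=; apply: eq_bigr => i _; rewrite mxE mulrDr.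
Qed.

Lemma dotpZl c u v : dotp (c *: u) v = c * dotp u v.
Proof.
by rewrite /dotp mulr_sumr; apply: eq_bigr => i _; rewrite mxE mulrA.
Qed.

Lemma dotpZr c u v : dotp u (c *: v) = c * dotp u v.
Proof.
by rewrite /dotp mulr_sumr; apply: eq_bigr => i _; rewrite mxE mulrCA.
Qed.

Lemma enormZ c u : enorm (c *: u) = `|c| * enorm u.
Proof.
rewrite /enorm -sqrtr_sqr -sqrtrM ?sqr_ge0// mulr_sumr; congr Num.sqrt.
by apply: eq_bigr => i _; rewrite mxE exprMn.
Qed.

Lemma enormN u : enorm (- u) = enorm u.
Proof. by rewrite -scaleN1r enormZ normrN1 mul1r. Qed.

Lemma enorm0 : enorm (0 : 'rV[R]_n) = 0.
Proof. by rewrite -(scale0r 0) enormZ normr0 mul0r. Qed.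

Lemma enorm_coord u i : `|u ord0 i| <= enorm u.
Proof.
rewrite -sqrtr_sqr ler_wsqrtr// (bigD1 i)//= lerDl sumr_ge0// => j _.
exact: sqr_ge0.
Qed.

Lemma enorm_eq0 u : enorm u = 0 -> u = 0.
Proof.
move=> u0; apply/rowP => i; rewrite mxE; apply/eqP; rewrite -normr_le0 -u0.
exact: enorm_coord.
Qed.

(** Cauchy-Schwarz: expand the square of the norm of |v| u - |u| v, which is nonnegative, and divide
    by |u| |v|; zero norms are treated apart. *)
Lemma dotp_le u v : dotp u v <= enorm u * enorm v.
Proof.
have [/enorm_eq0 ->|u0] := eqVneq (enorm u) 0.
  by rewrite -{1}(scale0r 0) dotpZl enorm0 !mul0r.
have [/enorm_eq0 ->|v0] := eqVneq (enorm v) 0.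
  by rewrite -{1}(scale0r 0) dotpZr enorm0 mul0r mulr0.
have a0 : 0 < enorm u by rewrite lt_neqAle eq_sym u0 enorm_ge0.
have b0 : 0 < enorm v by rewrite lt_neqAle eq_sym v0 enorm_ge0.
have ab0 : 0 < enorm u * enorm v by exact: mulr_gt0.
have dotpC : dotp v u = dotp u v.
  by apply: eq_bigr => i _; rewrite mulrC.
have := dotpuu (enorm v *: u + (- enorm u) *: v).
rewrite dotpDl !dotpDr !dotpZl !dotpZr dotpC !dotpuu => e.
have := sqr_ge0 (enorm (enorm v *: u - enorm u *: v)); rewrite -scaleNr -e => h.
rewrite -(ler_pM2l ab0); nra.
Qed.

Lemma ler_enormD u v : enorm (u + v) <= enorm u + enorm v.
Proof.
rewrite -(@ler_sqr _ (enorm (u + v))) ?nnegrE ?addr_ge0 ?enorm_ge0//.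
rewrite -dotpuu dotpDl !dotpDr !dotpuu.
have := dotp_le u v; have := dotp_le v u; nra.
Qed.

Lemma enorm_dist_sym u v : enorm (u - v) = enorm (v - u).
Proof. by rewrite -enormN opprB. Qed.

(** With [norm_le_enorm], this transfers limits between the Euclidean and the max norm; the crude
    constant n, instead of its square root, suffices. *)
Lemma enorm_le_norm u : enorm u <= n%:R * `|u|.
Proof.
have h i : `|u ord0 i| <= `|u|.
  rewrite [leRHS]/Num.Def.normr/= mx_normrE.
  exact: (le_bigmax (0 : R) (fun p => `|u p.1 p.2|) (ord0, i)).
have [n0|n0] := posnP n.
  suff -> : enorm u = 0 by rewrite mulr_ge0.
  rewrite /enorm big1 ?sqrtr0// => i _.
  by have := ltn_ord i; rewrite [X in (_ < X)%N -> _]n0 ltn0.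
rewrite -ler_sqr ?nnegrE ?enorm_ge0 ?mulr_ge0//.
rewrite sqr_sqrtr ?sumr_ge0//; last by move=> i _; exact: sqr_ge0.
apply: (@le_trans _ _ (\sum_(i < n) `|u| ^+ 2)).
  by apply: ler_sum => i _; rewrite -real_normK ?num_real// ler_sqr ?nnegrE.
rewrite sumr_const card_ord -[leLHS]mulr_natl exprMn ler_wpM2r ?sqr_ge0//.
by rewrite expr2 ler_peMr// ler1n.
Qed.

Lemma norm_le_enorm u : `|u| <= enorm u.
Proof.
rewrite [leLHS]/Num.Def.normr/= mx_normrE; apply/bigmax_leP; split.
  exact: enorm_ge0.
by move=> [i j] _ /=; rewrite ord1; exact: enorm_coord.
Qed.

Let dist_set x M := [set enorm (x - z) | z in M].

Let dist_lb x M : lbound (dist_set x M) 0.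
Proof. by move=> _ [z _ <-]; exact: enorm_ge0. Qed.

Lemma dist_le x M z : M z -> dist x M <= enorm (x - z).
Proof. by move=> Mz; apply: ge_inf; [exists 0; exact: dist_lb|exists z]. Qed.

Lemma dist_ge0 x M : M !=set0 -> 0 <= dist x M.
Proof.
by move=> [z Mz]; apply: lb_le_inf; [exists (enorm (x - z)), z|exact: dist_lb].
Qed.

Lemma dist_eq0 x M : M x -> dist x M = 0.
Proof.
move=> Mx; apply/eqP; rewrite eq_le dist_ge0 ?andbT; last by exists x.
by rewrite (le_trans (dist_le _ _ _ Mx))// subrr enorm0.
Qed.

Lemma dist_lt x M c : M !=set0 -> dist x M < c ->
  exists2 z, M z & enorm (x - z) < c.
Proof.
move=> [z Mz]; have S0 : dist_set x M !=set0 by exists (enorm (x - z)), z.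
by move=> /(inf_lt S0)[_ [w Mw <-] wc]; exists w.
Qed.

Lemma dist_lip x v M : M !=set0 -> dist x M <= enorm (x - v) + dist v M.
Proof.
move=> M0; rewrite -lerBlDl leNgt; apply/negP => /(dist_lt _ _ _ M0)[z Mz].
rewrite ltrBrDl; apply/negP; rewrite -leNgt.
rewrite (le_trans (dist_le _ _ _ Mz))//.
by rewrite (_ : x - z = x - v + (v - z)) ?ler_enormD// addrA subrK.
Qed.

(** The complement of M contains a max-norm ball around x, hence the smaller Euclidean ball of the
    same radius. *)
Lemma closed_notin x M : closed M -> ~ M x ->
  exists2 r : R, 0 < r & forall w, enorm (w - x) < r -> ~ M w.
Proof.
move=> cM Mx; have /(@nbhs_ballP R _) [r r0 xr] : nbhs x (~` M).
  by apply: open_nbhs_nbhs; split => //; exact: closed_openC.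
exists r => // w wr; apply: xr; rewrite -ball_normE /ball_/=.
by rewrite distrC (le_lt_trans (norm_le_enorm _)).
Qed.

End Euclidean.

(** * Translation of integrals and primitives of bounded measurable functions *)

Section Primitive.
Context {R : realType}.
Local Notation mu := (@lebesgue_measure R).
Implicit Types (f g : R -> R) (h c m s t : R) (D : set R).

(** Lebesgue measure is determined by the lengths of half-open intervals, which a translation
    preserves. *)
Lemma lebesgue_measure_shift h (A : set R) : measurable A ->
  pushforward mu ((fun x => h + x) : _ -> measurableTypeR R) A = mu A.
Proof.
move=> mA; apply/esym/lebesgue_measure_unique => //=.
  exact: measurable_funD.
move=> ? _ [[a b]] _ <-; rewrite /pushforward.
rewrite (_ : _ @^-1` _ = `]a - h, b - h]%classic); last first.
  by apply/seteqP; split => x /=; rewrite !in_itv/=; lra.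
rewrite !lebesgue_measure_itv/= !lte_fin ltrD2r; case: ifP => // _.
by rewrite -!EFinD; congr EFin; lra.
Qed.

(** For nonnegative integrands this is integration against a push-forward, which is Lebesgue measure
    again; positive and negative parts give the signed case. *)
Lemma integral_shift h D (F : R -> \bar R) :
  measurable D -> measurable_fun D F ->
  (\int[mu]_(x in D) F x = \int[mu]_(x in (fun x => (h + x)%R) @^-1` D) F (h + x)%R)%E.
Proof.
move=> mD mF.
have mh : measurable_fun [set: R] ((fun x => h + x) : _ -> measurableTypeR R).
  exact: measurable_funD.
have ge0 (G : R -> \bar R) : measurable_fun D G -> (forall x, 0 <= G x)%E ->
    (\int[mu]_(x in D) G x = \int[mu]_(x in (fun x => (h + x)%R) @^-1` D) G (h + x)%R)%E.
  move=> mG G0; transitivity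
      (\int[pushforward mu ((fun x => (h + x)%R) : _ -> measurableTypeR R)]_(x in D) G x)%E.
    by apply: eq_measure_integral => //= A mA AS; exact/esym/lebesgue_measure_shift.
  by rewrite ge0_integral_pushforward.
rewrite integralE [in RHS]integralE; congr (_ - _)%E.
- rewrite (ge0 (funepos F))//; last exact: measurable_funepos.
  by apply: eq_integral => x _; rewrite !funeposE.
- rewrite (ge0 (funeneg F))//; last exact: measurable_funeneg.
  by apply: eq_integral => x _; rewrite !funenegE.
Qed.

Definition primitive f t : R := \int[mu]_(s in `[0, t]) f s.

(** Such functions are integrable on bounded intervals of nonnegative times; coordinates of controls
    and running costs are of this kind. *)
Definition bounded_mfun f := measurable_fun (`[0, +oo[ : set R) f /\
  exists C : R, forall s, 0 <= s -> `|f s| <= C.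

Lemma bounded_mfun_integrable f (i : interval R) t : bounded_mfun f ->
  [set` i] `<=` `[0, t]%classic -> mu.-integrable [set` i] (EFin \o f).
Proof.
move=> [mf [C fC]] it; apply: measurable_bounded_integrable => //.
- apply: (@le_lt_trans _ _ (mu `[0, t]%classic)).
    by apply: le_measure; rewrite ?inE//.
  by rewrite lebesgue_measure_itv/=; case: ifP; rewrite ?ltry.
- apply: measurable_funS mf => // x /it/=; rewrite !in_itv/=; lra.
- exists C; split => [|r Cr s /it/=]; first exact: num_real.
  by rewrite in_itv/= => /andP[s0 _]; rewrite (le_trans (fC _ s0))// ltW.
Qed.

Lemma bounded_mfunS f s : bounded_mfun f -> 0 <= s -> bounded_mfun (fun r => f (s + r)).
Proof.
move=> [mf [C fC]] s0; split; last first.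
  by exists C => r r0; apply: fC; rewrite addr_ge0.
have ms : measurable_fun (`[0, +oo[ : set R) (fun r => s + r).
  exact: measurable_funD.
apply: (measurable_comp _ _ mf ms) => //.
by move=> _ [r /= + <-]; rewrite !in_itv/= !andbT; exact: addr_ge0.
Qed.

Lemma primitive0 f : primitive f 0 = 0.
Proof. by rewrite /primitive set_itv1 Rintegral_set1. Qed.

Lemma primitiveB f s t : bounded_mfun f -> 0 <= s <= t ->
  primitive f t - primitive f s = \int[mu]_(r in `]s, t]) f r.
Proof.
move=> bf /andP[s0 st]; rewrite /primitive Rintegral_itvB ?bnd_simp//.
exact: (bounded_mfun_integrable _ _ t).
Qed.

Lemma primitive_shift f s t : bounded_mfun f -> 0 <= s -> 0 <= t ->
  primitive f (s + t) = primitive f s + primitive (fun r => f (s + r)) t.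
Proof.
move=> bf s0 t0; rewrite [RHS]addrC; apply/eqP; rewrite -subr_eq; apply/eqP.
rewrite primitiveB ?s0 ?lerDl// /primitive -Rintegral_itv_obnd_cbnd; last first.
  apply: (bounded_mfun_integrable _ _ t); first exact: bounded_mfunS.
  by move=> x /=; rewrite !in_itv/=; lra.
rewrite /Rintegral; congr fine; rewrite (integral_shift s)//.
  congr integral; apply/seteqP; split => x /=; rewrite !in_itv/=; lra.
have [mf _] := bf; apply/measurable_EFinP; apply: measurable_funS mf => // x /=.
by rewrite !in_itv/=; lra.
Qed.

Lemma primitive_le f c s t : bounded_mfun f -> 0 <= s <= t ->
  (forall r, s < r <= t -> f r <= c) -> primitive f t - primitive f s <= c * (t - s).
Proof.
move=> bf /andP[s0 st] fc; rewrite primitiveB ?s0//.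
have sub : `]s, t]%classic `<=` `[0, t]%classic.
  by move=> x /=; rewrite !in_itv/=; lra.
apply: (@le_trans _ _ (\int[mu]_(_ in `]s, t]) c)).
  apply: le_Rintegral => //; first exact: bounded_mfun_integrable sub.
    apply: (bounded_mfun_integrable _ _ t) => //; split; first exact: measurable_cst.
    by exists `|c|.
rewrite Rintegral_cst//= lebesgue_measure_itv/= lte_fin.
by case: ltP => //= ts; have -> : t - s = 0 by lra.
Qed.

Lemma bounded_mfun_lin c m f g : bounded_mfun f -> bounded_mfun g ->
  bounded_mfun (fun s => c * f s + m * g s).
Proof.
move=> [mf [C fC]] [mg [E gE]]; split.
  by apply: measurable_funD; apply: measurable_funM.
exists (`|c| * C + `|m| * E) => s s0; rewrite (le_trans (ler_normD _ _))//.
by rewrite !normrM lerD// ler_wpM2l// ?fC ?gE.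
Qed.

Lemma bounded_mfun_cst c : bounded_mfun (cst c).
Proof. by split; [exact: measurable_cst|exists `|c|]. Qed.

Lemma primitive_lin c m f g t : bounded_mfun f -> bounded_mfun g ->
  primitive (fun s => c * f s + m * g s) t = c * primitive f t + m * primitive g t.
Proof.
move=> bf bg; have If := bounded_mfun_integrable _ `[0, t] t bf (@subset_refl _ _).
have Ig := bounded_mfun_integrable _ `[0, t] t bg (@subset_refl _ _).
have IZ k (h : R -> R) : mu.-integrable `[0, t] (EFin \o h) ->
    mu.-integrable `[0, t] (EFin \o (fun s => k * h s)).
  move=> Ih; rewrite (_ : EFin \o _ = (fun x => k%:E * (EFin \o h) x)%E).
    by apply: integrableZl.
  by apply/funext => x; rewrite /= EFinM.
by rewrite /primitive RintegralD ?RintegralZl//; exact: IZ.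
Qed.

Lemma primitive_ge f c s t : bounded_mfun f -> 0 <= s <= t ->
  (forall r, s < r <= t -> c <= f r) -> c * (t - s) <= primitive f t - primitive f s.
Proof.
move=> bf st fc.
have bN : bounded_mfun (fun r => -1 * f r + 0 * cst 0 r).
  by apply: bounded_mfun_lin => //; exact: bounded_mfun_cst.
have := primitive_le _ (- c) _ _ bN st.
rewrite !primitive_lin//; [|exact: bounded_mfun_cst|exact: bounded_mfun_cst] => /(_ _).
rewrite !mul0r !addr0 !mulN1r => h.
suff : - primitive f t - - primitive f s <= - c * (t - s) by lra.
by apply: h => r rst; rewrite mul0r addr0 mulN1r lerN2 fc.
Qed.

(** Meant for the inner product of a fixed vector with a control. Boundedness is carried through the
    induction because linearity of the integral requires it. *)
Lemma primitive_sum (I : Type) (r : seq I) (c : I -> R) (F : I -> R -> R) t :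
  (forall i, bounded_mfun (F i)) ->
  bounded_mfun (fun s => \sum_(i <- r) c i * F i s) /\
  primitive (fun s => \sum_(i <- r) c i * F i s) t = \sum_(i <- r) c i * primitive (F i) t.
Proof.
move=> bF; elim: r => [|i r [IH1 IH2]].
  rewrite big_nil (_ : (fun _ => _) = cst 0); last first.
    by apply/funext => s; rewrite big_nil.
  by split; [exact: bounded_mfun_cst|rewrite /primitive Rintegral_cst// mul0r].
rewrite (_ : (fun _ => _) =
    (fun s => c i * F i s + 1 * (\sum_(i <- r) c i * F i s))); last first.
  by apply/funext => s; rewrite big_cons mul1r.
split; first exact: bounded_mfun_lin.
by rewrite primitive_lin// big_cons mul1r IH2.
Qed.

End Primitive.

(** * Trajectories: semigroup law, speed at most 1, continuity *)

Section Trajectories.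
Context {R : realType} {n : nat}.
Implicit Types (x z : 'rV[R]_n) (a b : R -> 'rV[R]_n) (s t h : R)
  (M : set 'rV[R]_n).

Definition delay h a : R -> 'rV[R]_n := fun s => a (h + s).

Lemma admissible_bounded_mfun a i : admissible a -> bounded_mfun (fun s => a s ord0 i).
Proof.
move=> [ma a1]; split; first exact: ma.
by exists 1 => s s0; rewrite (le_trans (enorm_coord _ _))// a1.
Qed.

Lemma admissible_delay h a : admissible a -> 0 <= h -> admissible (delay h a).
Proof.
move=> aa h0; split => [i|s s0].
  by have [] := bounded_mfunS _ _ (admissible_bounded_mfun _ i aa) h0.
by apply: aa.2; rewrite addr_ge0.
Qed.

Lemma trajectoryE x a t i :
  trajectory x a t ord0 i = x ord0 i + primitive (fun s => a s ord0 i) t.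
Proof. by rewrite mxE. Qed.

Lemma trajectory_neg x a t : t <= 0 -> trajectory x a t = x.
Proof.
move=> t0; apply/rowP => i; rewrite trajectoryE; move: t0; rewrite le_eqVlt.
move=> /predU1P[->|t0]; first by rewrite primitive0 addr0.
by rewrite /primitive set_itv_ge ?Rintegral_set0 ?addr0// bnd_simp -ltNge.
Qed.

Lemma trajectory_delay x a h t : admissible a -> 0 <= h -> 0 <= t ->
  trajectory (trajectory x a h) (delay h a) t = trajectory x a (h + t).
Proof.
move=> aa h0 t0; apply/rowP => i; rewrite !trajectoryE primitive_shift ?addrA//.
exact: admissible_bounded_mfun.
Qed.

(* Testing y(t) - y(s) against itself reduces the bound to Cauchy-Schwarz for
   the integrand. *)
Lemma trajectory_speed x a s t : admissible a -> 0 <= s <= t ->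
  enorm (trajectory x a t - trajectory x a s) <= t - s.
Proof.
move=> aa st; set u := trajectory x a t - trajectory x a s.
have [u0|u0] := eqVneq (enorm u) 0; first by rewrite u0; lra.
have {}u0 : 0 < enorm u by rewrite lt_neqAle eq_sym u0 enorm_ge0.
rewrite -(ler_pM2l u0) -expr2 -dotpuu.
pose f r := \sum_(i < n) u ord0 i * a r ord0 i.
have P r := primitive_sum _ (index_enum 'I_n) (fun i => u ord0 i) _ r
  (fun i => admissible_bounded_mfun a i aa).
rewrite (_ : dotp u u = primitive f t - primitive f s).
  apply: primitive_le => //; first by have [] := P 0.
  move=> r /andP[sr _]; apply: le_trans (dotp_le u (a r)) _.
  by rewrite ler_piMr ?enorm_ge0// aa.2//; lra.
rewrite (P t).2 (P s).2 -sumrB; apply: eq_bigr => i _.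
by rewrite -mulrBr {2}/u !mxE; congr (_ * _); rewrite /primitive; lra.
Qed.

(** By [trajectory_speed] it is 1-Lipschitz at nonnegative times, and it is constant before 0;
    clamping time at 0 joins the two cases. *)
Lemma trajectory_continuous x a : admissible a -> continuous (trajectory x a).
Proof.
move=> aa; have pos t : trajectory x a t = trajectory x a (Num.max 0 t).
  by case: (leP 0 t) => // /ltW t0; rewrite !trajectory_neg.
have lip s t : `|trajectory x a s - trajectory x a t| <= `|s - t|.
  wlog st : s t / s <= t.
    move=> H; have [|/ltW] := leP s t; first exact: H.
    by move=> ts; rewrite distrC [leRHS]distrC; exact: H.
  rewrite distrC [leRHS]distrC (pos t) (pos s) (le_trans (norm_le_enorm _))//.
  rewrite (le_trans (trajectory_speed _ _ _ _ aa _))//.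
    by case: (leP 0 s); case: (leP 0 t); lra.
  rewrite [leRHS]ger0_norm ?subr_ge0//.
  by case: (leP 0 t); case: (leP 0 s); lra.
move=> t; apply/cvgrPdist_lt => e e0; near=> s.
rewrite (le_lt_trans (lip _ _))//.
Unshelve. all: by end_near. Qed.

End Trajectories.

(** * Hitting times and their behaviour under delay *)

Section Cost.
Context {R : realType} {n : nat} (M : set 'rV[R]_n) (l : 'rV[R]_n -> R).
Implicit Types (x z : 'rV[R]_n) (a b : R -> 'rV[R]_n) (s t h : R).
Local Notation mu := (@lebesgue_measure R).

(** The domain of integration of [cost]: the interval from 0 to the hitting time, open on the
    right. *)
Definition before_hit x a : set R :=
  [set s : R | (0 <= s)%R /\ (s%:E < hitting_time M x a)%E].

Lemma costE x a :
  (cost M l x a = \int[mu]_(s in before_hit x a) (l (trajectory x a s))%:E)%E.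
Proof. by []. Qed.

Lemma cost_ext x z a b : trajectory x a = trajectory z b ->
  cost M l x a = cost M l z b.
Proof. by rewrite /cost /hitting_time => ->. Qed.

Lemma hitting_time_le x a s : 0 <= s -> M (trajectory x a s) ->
  (hitting_time M x a <= s%:E)%E.
Proof. by move=> s0 Ms; apply: ereal_inf_lbound; exists s. Qed.

Lemma before_hit_notin x a s : before_hit x a s -> ~ M (trajectory x a s).
Proof.
by move=> [s0]; rewrite ltNge => /negP H Ms; apply: H; exact: hitting_time_le.
Qed.

Lemma before_hitW x a s t : before_hit x a t -> 0 <= s <= t -> before_hit x a s.
Proof.
by move=> [t0 th] /andP[s0 st]; split => //; rewrite (le_lt_trans _ th)// lee_fin.
Qed.

Lemma measurable_before_hit x a : measurable (before_hit x a).
Proof.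
rewrite /before_hit; case: (hitting_time M x a) => [r| |].
- rewrite (_ : mkset _ = `[0, r[%classic)//.
  by apply/seteqP; split => s /=; rewrite in_itv/= lte_fin; [move=> [-> ->]|move=> /andP[]].
- rewrite (_ : mkset _ = `[0, +oo[%classic)//.
  by apply/seteqP; split => s /=; rewrite in_itv/= andbT; [move=> []|move=> ->; rewrite ltry].
- by rewrite (_ : mkset _ = set0)//; apply/seteqP; split => s //= [].
Qed.

(** A hit of the delayed trajectory at s is a hit of the original one at h + s. *)
Lemma hitting_time_delay_le x a h : admissible a -> 0 <= h ->
  (hitting_time M x a <= h%:E + hitting_time M (trajectory x a h) (delay h a))%E.
Proof.
move=> aa h0; rewrite -leeBlDl//; apply: le_ereal_inf_tmp => _ [s [s0 Ms] <-].
rewrite leeBlDl// -EFinD; apply: hitting_time_le; first exact: addr_ge0.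
by rewrite -trajectory_delay.
Qed.

(** As M is not hit up to time h, every hit occurs at some s >= h and is seen by the delayed
    trajectory at s - h. *)
Lemma hitting_time_delay_ge x a h : admissible a -> before_hit x a h ->
  (h%:E + hitting_time M (trajectory x a h) (delay h a) <= hitting_time M x a)%E.
Proof.
move=> aa xh; have h0 := xh.1; apply: le_ereal_inf_tmp => _ [s [s0 Ms] <-].
have hs : h <= s.
  rewrite leNgt; apply/negP => /ltW sh; apply: (before_hit_notin _ _ s _ Ms).
  by apply: before_hitW xh _; rewrite s0.
rewrite -(subrKC h s) EFinD leeD2l//; apply: hitting_time_le; first by rewrite subr_ge0.
by rewrite trajectory_delay ?subr_ge0// subrKC.
Qed.

End Cost.

(** * Controls that are constant up to time h and then follow another control *)

Section Concatenation.
Context {R : realType} {n : nat}.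
Implicit Types (x u : 'rV[R]_n) (a b : R -> 'rV[R]_n) (s t h : R).

Definition concat h u b : R -> 'rV[R]_n :=
  fun s => if s <= h then u else b (s - h).

Lemma admissible_concat h u b : 0 <= h -> enorm u <= 1 -> admissible b ->
  admissible (concat h u b).
Proof.
move=> h0 u1 [mb b1]; split => [i|s s0]; last first.
  by rewrite /concat; case: (leP s h) => // hs; rewrite b1// subr_ge0 ltW.
rewrite (_ : (fun s => _) = (fun s =>
    if s <= h then u ord0 i else b (s - h) ord0 i)); last first.
  by apply/funext => s; rewrite /concat; case: ifP.
apply: measurable_fun_if => //.
- exact: measurable_fun_ler.
have ms : measurable_fun (`[0, +oo[%classic `&` (fun s => s <= h) @^-1` [set false] : set R)
    (fun s => s - h).
  exact: measurable_funB.
apply: (measurable_comp _ _ (mb i) ms) => //.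
move=> _ [s /= [_ /negbT +] <-]; rewrite -ltNge in_itv/= andbT subr_ge0.
exact: ltW.
Qed.

Lemma trajectory_concat x h u b : 0 <= h -> enorm u <= 1 -> admissible b ->
  trajectory x (concat h u b) h = x + h *: u.
Proof.
move=> h0 u1 ab; apply/rowP => i; rewrite trajectoryE !mxE; congr (_ + _).
have bc : bounded_mfun (fun s => concat h u b s ord0 i).
  by apply: admissible_bounded_mfun; exact: admissible_concat.
have h1 : (0 : R) <= 0 <= h by apply/andP; split.
have cu s : 0 < s <= h -> concat h u b s ord0 i = u ord0 i.
  by move=> /andP[_ sh]; rewrite /concat sh.
have := primitive_le _ (u ord0 i) _ _ bc h1.
have := primitive_ge _ (u ord0 i) _ _ bc h1.
rewrite primitive0 !subr0 mulrC => H1 H2; apply/eqP; rewrite eq_le H2 ?H1// => r rh;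
  by rewrite cu.
Qed.

Lemma trajectory_delay_concat x h u b : 0 <= h -> enorm u <= 1 -> admissible b ->
  trajectory x (delay h (concat h u b)) = trajectory x b.
Proof.
move=> h0 u1 ab; apply/funext => t.
have [t0|/ltW t0] := leP t 0; first by rewrite !trajectory_neg.
have bd : admissible (delay h (concat h u b)).
  by apply: admissible_delay => //; exact: admissible_concat.
apply/rowP => i; rewrite !trajectoryE; congr (_ + _).
have bc := admissible_bounded_mfun _ i bd.
have bb := admissible_bounded_mfun _ i ab.
have t1 : (0 : R) <= 0 <= t by apply/andP; split.
(* At time 0 the delayed control still has the value [u]; integrating over ]0, t] discards this
   single time. *)
have primitive_oc f : bounded_mfun f -> primitive f t =
    \int[lebesgue_measure]_(r in `]0, t]) f r.
  by move=> bf; rewrite -primitiveB// primitive0 subr0.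
rewrite !primitive_oc//.
apply: eq_Rintegral => s; rewrite inE/= in_itv/= => /andP[s0 _].
by rewrite /delay /concat leNgt ltrDl s0/= addrC addKr.
Qed.

Lemma admissible0 : admissible (cst (0 : 'rV[R]_n)).
Proof.
split=> [i|s s0]; first exact: measurable_cst.
by rewrite enorm0.
Qed.

End Concatenation.

(** * Splitting the cost at a time h; the value function is finite and Lipschitz *)

Section Value.
Context {R : realType} {n : nat} (M : set 'rV[R]_n) (l : 'rV[R]_n -> R) (C : R).
Hypothesis l_continuous : continuous l.
Hypothesis l_ge0 : forall x, 0 <= l x.
Hypothesis l_le : forall x, l x <= C.
Implicit Types (x z : 'rV[R]_n) (a b : R -> 'rV[R]_n) (s t h : R).
Local Notation mu := (@lebesgue_measure R).

Lemma running_cost_continuous x a : admissible a ->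
  continuous (fun s => l (trajectory x a s)).
Proof.
move=> aa s; apply: continuous_comp; first exact: trajectory_continuous.
exact: l_continuous.
Qed.

Lemma measurable_running_cost x a (D : set R) : admissible a ->
  measurable_fun D (fun s => l (trajectory x a s)).
Proof.
move=> aa; apply: measurable_funTS; apply: open_continuous_measurable_fun.
  exact: openT.
by move=> s _; exact: running_cost_continuous.
Qed.

Lemma running_cost_bounded_mfun x a : admissible a ->
  bounded_mfun (fun s => l (trajectory x a s)).
Proof.
move=> aa; split; first exact: measurable_running_cost.
by exists C => s _; rewrite ger0_norm.
Qed.

Lemma cost_ge0 x a : (0 <= cost M l x a)%E.
Proof. by apply: integral_ge0 => s _; rewrite lee_fin. Qed.

(** The running times of the delayed problem, read on the original clock, so that both costs
    integrate the same function. *)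
Let delayed_hit x a h : set R :=
  (fun s => - h + s) @^-1` before_hit M (trajectory x a h) (delay h a).

Let measurable_delayed_hit x a h : measurable (delayed_hit x a h).
Proof.
have mh : measurable_fun [set: R] (fun s => - h + s) by exact: measurable_funD.
rewrite /delayed_hit -[X in measurable X]setTI.
by apply: mh => //; exact: measurable_before_hit.
Qed.

Let delayed_hit_disj x a h : [disjoint `[0, h[%classic & delayed_hit x a h].
Proof.
apply/disj_setPS => s [/=]; rewrite in_itv/= => /andP[_ sh] [+ _].
by rewrite addrC subr_ge0 leNgt sh.
Qed.

Let cost_delay x a h : admissible a -> 0 <= h ->
  (cost M l (trajectory x a h) (delay h a) =
    \int[mu]_(s in delayed_hit x a h) (l (trajectory x a s))%:E)%E.
Proof.
move=> aa h0; rewrite costE (integral_shift (- h)); first last.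
- by apply/measurable_EFinP; apply: measurable_running_cost; exact: admissible_delay.
- exact: measurable_before_hit.
apply: eq_integral => s /set_mem[s0 _].
by rewrite trajectory_delay// addNKr.
Qed.

(** The running times are covered by [0, h[, which costs at most C h, and by [delayed_hit]. M may be
    hit before h, hence only an inclusion. *)
Lemma cost_delay_le x a h : admissible a -> 0 <= h ->
  (cost M l x a <= (C * h)%:E + cost M l (trajectory x a h) (delay h a))%E.
Proof.
move=> aa h0; rewrite cost_delay//.
have mE D : measurable_fun D (fun s => (l (trajectory x a s))%:E).
  by apply/measurable_EFinP; exact: measurable_running_cost.
apply: (@le_trans _ _
  (\int[mu]_(s in `[0%R, h[ `|` delayed_hit x a h) (l (trajectory x a s))%:E)%E).
  apply: ge0_subset_integral => //.
  - exact: measurable_before_hit.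
  - by apply: measurableU => //; exact: measurable_delayed_hit.
  - exact: mE.
  - by move=> s _; rewrite lee_fin.
  - move=> s [s0 sh]; have [hs|hs] := ltP s h.
      by left; rewrite /= in_itv/= s0.
    right; split; first by rewrite addrC subr_ge0.
    have := lt_le_trans sh (hitting_time_delay_le M x a h aa h0).
    by rewrite -lteBlDl// [(- h + s)%R]addrC EFinB.
rewrite ge0_integral_setU//; last 3 first.
- exact: measurable_delayed_hit.
- exact: mE.
- by move=> s _; rewrite lee_fin.
rewrite leeD2r//; apply: (@le_trans _ _ (\int[mu]_(s in `[0%R, h[) (cst C%:E) s)%E).
  apply: ge0_le_integral => //.
  - by move=> s _; rewrite lee_fin.
  - exact: mE.
  - by move=> s _; rewrite lee_fin.
rewrite integral_cst//= lebesgue_measure_itv/= lte_fin.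
case: ltP => [_|h1]; first by rewrite sube0 EFinM.
by rewrite mule0 lee_fin (_ : h = 0) ?mulr0//; lra.
Qed.

(** Before the hitting time, [0, h[ and [delayed_hit] are disjoint sets of running times. This gives
    dynamic programming from below, and the cost bound for cost-optimal controls. *)
Lemma cost_delay_ge x a h : admissible a -> before_hit M x a h ->
  ((primitive (fun s => l (trajectory x a s)) h)%:E +
    cost M l (trajectory x a h) (delay h a) <= cost M l x a)%E.
Proof.
move=> aa xh; have h0 := xh.1; rewrite cost_delay//.
have mE D : measurable_fun D (fun s => (l (trajectory x a s))%:E).
  by apply/measurable_EFinP; exact: measurable_running_cost.
have -> : ((primitive (fun s => l (trajectory x a s)) h)%:E =
    \int[mu]_(s in `[0%R, h[) (l (trajectory x a s))%:E)%E.
  rewrite integral_itv_bndo_bndc// /primitive fineK//; apply: integrable_fin_num => //.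
  by apply: (bounded_mfun_integrable _ _ h) => //; exact: running_cost_bounded_mfun.
rewrite -ge0_integral_setU//; last 3 first.
- exact: measurable_delayed_hit.
- exact: mE.
- by move=> s _; rewrite lee_fin.
apply: ge0_subset_integral => //.
- by apply: measurableU => //; exact: measurable_delayed_hit.
- exact: measurable_before_hit.
- exact: mE.
- by move=> s _; rewrite lee_fin.
- move=> s [|[]].
    by rewrite /= in_itv/= => /andP[s0 /ltW sh]; apply: before_hitW xh _; rewrite s0.
  rewrite addrC subr_ge0 EFinB => hs; rewrite lteBlDl// => sh.
  split; first exact: le_trans hs.
  exact: lt_le_trans (hitting_time_delay_ge _ _ _ _ aa xh).
Qed.

Lemma evalue_ge0 x : (0 <= evalue M l x)%E.
Proof. by apply: le_ereal_inf_tmp => _ [a _ <-]; exact: cost_ge0. Qed.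

Lemma evalue_le x a : admissible a -> (evalue M l x <= cost M l x a)%E.
Proof. by move=> aa; apply: ereal_inf_lbound; exists a. Qed.

Lemma evalue_target z : M z -> evalue M l z = 0.
Proof.
move=> Mz; apply/eqP; rewrite eq_le evalue_ge0 andbT.
rewrite (le_trans (evalue_le _ _ admissible0))// costE.
rewrite (_ : before_hit _ _ _ = set0) ?integral_set0//.
apply/seteqP; split => s //= [s0]; rewrite ltNge => /negP; apply.
apply: le_trans (hitting_time_le _ _ _ 0 _ _) _ => //.
by rewrite trajectory_neg.
Qed.

(* Go straight from x to z, then follow a control for z. *)
Lemma evalue_lip x z :
  (evalue M l x <= (C * enorm (x - z))%:E + evalue M l z)%E.
Proof.
rewrite -leeBlDl//; apply: le_ereal_inf_tmp => _ [b ab <-]; rewrite leeBlDl//.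
(* If x = z there is no direction to normalise; otherwise unit speed during h = |x - z| leads from x
   to z. *)
have [e0|e0] := eqVneq (enorm (x - z)) 0.
  move: (e0) => /enorm_eq0/eqP; rewrite subr_eq0 => /eqP ->.
  by rewrite subrr enorm0 mulr0 add0e evalue_le.
set h := enorm (x - z) in e0 *.
have h0 : 0 <= h by exact: enorm_ge0.
pose u := h^-1 *: (z - x).
have u1 : enorm u <= 1.
  by rewrite enormZ normfV enorm_dist_sym -/h ger0_norm// mulVf.
have ac : admissible (concat h u b) by exact: admissible_concat.
rewrite (le_trans (evalue_le _ _ ac))//.
rewrite (le_trans (cost_delay_le _ _ _ ac h0))// leeD2l//.
rewrite (cost_ext _ _ _ z _ b)// trajectory_delay_concat//.
by rewrite trajectory_concat// scalerA divff// scale1r subrKC.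
Qed.

Hypothesis M_nonempty : M !=set0.

(** Points of M have value 0, and [evalue_lip] compares any x with one of them. *)
Lemma evalue_fin x : evalue M l x = (value M l x)%:E.
Proof.
have [z Mz] := M_nonempty; rewrite /value fineK// ge0_fin_numE ?evalue_ge0//.
by rewrite (le_lt_trans (evalue_lip x z))// evalue_target// adde0 ltry.
Qed.

Lemma value_lip x z : value M l x <= C * enorm (x - z) + value M l z.
Proof. by rewrite -lee_fin EFinD -!evalue_fin evalue_lip. Qed.

Lemma value_ge0 x : 0 <= value M l x.
Proof. by rewrite -lee_fin -evalue_fin evalue_ge0. Qed.

Lemma value_target_le x z : M z -> value M l x <= C * enorm (x - z).
Proof.
move=> Mz; have := value_lip x z; suff -> : value M l z = 0 by rewrite addr0.
by apply: EFin_inj; rewrite -evalue_fin evalue_target.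
Qed.

End Value.

(** * Monotonicity from one-sided difference quotients *)

Section LeftMonotonicity.
Context {R : realType}.
Local Notation mu := (@lebesgue_measure R).
Implicit Types (g : R -> R) (e h s t K T : R).

(** Take the infimum of the times s with g(T) <= g(s). By the Lipschitz bound it is such a time
    itself; were it positive, a step to the left would give a smaller one. *)
Lemma left_nonincreasing g K T : 0 <= T -> 0 <= K ->
  (forall s t, 0 <= s <= t -> t <= T -> g s - g t <= K * (t - s) /\
     g t - g s <= K * (t - s)) ->
  (forall s, 0 < s <= T -> exists2 d : R, 0 < d &
     forall h, 0 < h < d -> h <= s -> g s <= g (s - h)) ->
  g T <= g 0.
Proof.
move=> T0 K0 lip dec.
pose S := [set s | 0 <= s <= T /\ g T <= g s].
have ST : S T by split=> //; rewrite T0 lexx.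
have S0 : lbound S 0 by move=> s [/andP[]].
have infS : has_inf S by split; [exists T|exists 0].
set s0 := inf S.
have s00 : 0 <= s0 by apply: lb_le_inf => //; exists T.
have s0T : s0 <= T by apply: ge_inf => //; exists 0.
have gs0 : g T <= g s0.
  apply/ler_addgt0Pr => e e0.
  have e1 : 0 < e / (K + 1) by rewrite divr_gt0//; lra.
  have [s [/andP[s1 sT] gs] ss] := inf_adherent e1 infS.
  have s0s : s0 <= s by apply: ge_inf; [exists 0|split=> //; rewrite s1].
  have s0s' : 0 <= s0 <= s by rewrite s00.
  have [_] := lip s0 s s0s' sT.
  have : K * (s - s0) <= e.
    apply: (@le_trans _ _ ((K + 1) * (e / (K + 1)))).
      by apply: ler_pM => //; rewrite ?subr_ge0 ?lerDl// lerBlDl ltW.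
    by rewrite mulrC divfK//; lra.
  by lra.
move: s00; rewrite le_eqVlt => /predU1P[->//|s00].
have s0T' : 0 < s0 <= T by rewrite s00.
have [d d0 H] := dec s0 s0T'.
pose h := Num.min (d / 2) s0.
have hd : 0 < h /\ h < d /\ h <= s0.
  by rewrite /h; case: (leP (d / 2) s0); lra.
have Ss : S (s0 - h).
  split; first by apply/andP; lra.
  by rewrite (le_trans gs0)// H//; lra.
have : s0 <= s0 - h by apply: ge_inf => //; exists 0.
by lra.
Qed.

(* Exceptional times are absorbed by K times the measure, up to time s, of a
   small open set U containing them: this function grows at rate K near every
   point of U. *)
Lemma ae_left_nonincreasing g K T : 0 <= T -> 0 <= K ->
  (forall s t, 0 <= s <= t -> t <= T -> g s - g t <= K * (t - s) /\
     g t - g s <= K * (t - s)) ->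
  {ae mu, forall s, 0 < s <= T -> forall e, 0 < e -> exists2 d : R, 0 < d &
     forall h, 0 < h < d -> h <= s -> g s - g (s - h) <= e * h} ->
  g T <= g 0.
Proof.
move=> T0 K0 lip [N [mN N0 PN]].
(* The slack at ordinary times adds up to e T; the exceptional ones contribute at most K times the
   measure of U, which is below e. *)
suff H e : 0 < e -> g T <= g 0 + e * (T + K).
  apply/ler_addgt0Pr => e e0.
  have TK : 0 < T + K + 1 by lra.
  have := H (e / (T + K + 1)) (divr_gt0 e0 TK).
  suff : e / (T + K + 1) * (T + K) <= e by lra.
  by rewrite -mulrA ler_piMr ?ltW// mulrC ltr_pdivrMr//; lra.
move=> e0; have Noo : (mu N < +oo)%E by rewrite N0 ltry.
have [U [oU NU Ue]] := lebesgue_regularity_outer mN Noo e0.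
have mU : measurable U by exact: open_measurable.
have muU : (mu U < e%:E)%E.
  rewrite (le_lt_trans _ Ue)// (_ : mu U = mu (U `\` N))// -[in LHS](setDUK NU).
  rewrite measureU//=; first by rewrite N0 add0e.
    exact: measurableD.
  by rewrite setDIK.
pose m := primitive (\1_U : R -> R).
have bU : bounded_mfun (\1_U : R -> R).
  split; first exact: measurable_indic.
  by exists 1 => s _; rewrite ger0_norm indicE; case: (_ \in _).
have m1 s t : 0 <= s <= t -> 0 <= m t - m s <= t - s.
  move=> st; apply/andP; split.
    by rewrite -(mul0r (t - s)) primitive_ge// => r _; rewrite indicE; case: (_ \in _).
  by rewrite -(mul1r (t - s)) primitive_le// => r _; rewrite indicE; case: (_ \in _).
have mT : m T <= e.
  rewrite /m /primitive /Rintegral integral_indic// -lee_fin fineK.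
    by rewrite (le_trans _ (ltW muU))// le_measure ?inE//; exact: measurableI.
  rewrite ge0_fin_numE//; apply: le_lt_trans (lt_trans muU (ltry e)).
  by rewrite le_measure ?inE//; exact: measurableI.
(* The term in e cancels the error at ordinary times and the term in K the growth of g near
   exceptional ones, so [left_nonincreasing] applies without error. *)
pose G s := g s - e * s - K * m s.
suff : G T <= G 0.
  rewrite /G [m 0]primitive0 => GT.
  have : K * m T <= K * e by exact: ler_wpM2l.
  by lra.
apply: (left_nonincreasing G (K + e + K)) => //; first by lra.
  move=> s t st tT; have [g1 g2] := lip s t st tT.
  have /andP[m0 m2] := m1 s t st; rewrite /G.
  have : 0 <= K * (m t - m s) by exact: mulr_ge0.
  have : K * (m t - m s) <= K * (t - s) by exact: ler_wpM2l.
  have : 0 <= e * (t - s) by apply: mulr_ge0; lra.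
  by lra.
move=> s /andP[s0 sT].
(* At an exceptional time, m has slope 1 on a left neighbourhood contained in U, so K m grows at
   least as fast as g. *)
have [Ns|Ns] := pselect (N s).
  have /(@nbhs_ballP R _) [r /= r0 sr] : nbhs s U.
    by apply: open_nbhs_nbhs; split => //; exact: NU.
  exists r => // h /andP[h0 hr] hs.
  have sh : 0 <= s - h <= s by lra.
  have [_ g2] := lip _ _ sh sT.
  have : 1 * (s - (s - h)) <= m s - m (s - h).
    apply: primitive_ge => // q sq; rewrite indicE mem_set//; apply: sr.
    by rewrite -ball_normE /ball_/= ger0_norm; lra.
  rewrite mul1r => m2.
  have : K * (s - (s - h)) <= K * (m s - m (s - h)) by exact: ler_wpM2l.
  have : 0 <= e * h by rewrite mulr_ge0 ?ltW.
  by rewrite /G; lra.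
have [d d0 H] : exists2 d : R, 0 < d &
    forall h, 0 < h < d -> h <= s -> g s - g (s - h) <= e * h.
  apply: contrapT => H; apply: Ns; apply: PN => /= P; apply: H.
  by apply: P => //; rewrite s0.
exists d => // h hd hs; have := H _ hd hs.
have sh : 0 <= s - h <= s by lra.
have /andP[m0 _] := m1 _ _ sh.
have : 0 <= K * (m s - m (s - h)) by exact: mulr_ge0.
by rewrite /G; lra.
Qed.

End LeftMonotonicity.

(** * The subdifferential in epsilon-delta form *)

Section Subdifferential.
Context {R : realType} {n : nat}.
Implicit Types (v : 'rV[R]_n -> R) (x z p : 'rV[R]_n) (e : R).

(** Unfolds the lower limit over Euclidean balls; at x = z, excluded from the punctured
    neighbourhoods, both sides vanish. *)
Lemma subdifferential_near v z p e : subdifferential v z p -> 0 < e ->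
  exists2 d : R, 0 < d & forall x, enorm (x - z) < d ->
    dotp p (x - z) - e * enorm (x - z) <= v x - v z.
Proof.
rewrite /subdifferential/= limf_einfE => H e0.
have : ((- e)%:E < 0)%E by rewrite lte_fin oppr_lt0.
move=> /lt_le_trans /(_ H) /ereal_sup_gt[_ [V zV <-] eV].
have /(@nbhs_ballP R _) [r /= r0 zr] := zV; exists r => // x xr.
have [->|xz] := eqVneq x z.
  by rewrite !subrr enorm0 -(scale0r 0) dotpZr !mul0r mulr0 subr0.
have Vx : V x.
  apply: zr => //; rewrite -ball_normE /ball_/= distrC.
  by rewrite (le_lt_trans (norm_le_enorm _)).
have x0 : 0 < enorm (x - z).
  rewrite lt_neqAle enorm_ge0 andbT; apply/eqP => /esym/enorm_eq0/eqP.
  by rewrite subr_eq0; exact/negP.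
have : ((- e)%:E < ((v x - v z - dotp p (x - z)) / enorm (x - z))%:E)%E.
  by apply: lt_le_trans eV _; apply: ereal_inf_lbound; exists x.
by rewrite lte_fin ltr_pdivlMr//; lra.
Qed.

End Subdifferential.

(** * Supersolution property of v and decay of v along the inclusion *)

Section Dissipation.
Context {R : realType} {n : nat} (M : set 'rV[R]_n) (l : 'rV[R]_n -> R) (C : R).
Hypothesis l_continuous : continuous l.
Hypothesis l_ge0 : forall x, 0 <= l x.
Hypothesis l_le : forall x, l x <= C.
Hypothesis M_nonempty : M !=set0.
Implicit Types (x z p : 'rV[R]_n) (a b : R -> 'rV[R]_n) (e s t h : R).

Let v := value M l.
Let vE := evalue_fin M l C l_continuous l_ge0 l_le M_nonempty.

(* The half of the dynamic programming principle that bounds v from below. *)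
Lemma value_near_optimal z h e : 0 < e ->
  (forall a, admissible a -> before_hit M z a h) ->
  exists2 a, admissible a &
    primitive (fun s => l (trajectory z a s)) h + v (trajectory z a h) <= v z + e.
Proof.
move=> e0 hit; have fz : evalue M l z \is a fin_num by rewrite vE.
have [_ [a aa <-] ca] := lb_ereal_inf_adherent e0 fz; exists a => //.
rewrite -lee_fin !EFinD -!vE.
have h0 := (hit a aa).1.
apply: le_trans (ltW ca).
apply: le_trans (cost_delay_ge _ _ C _ _ _ _ _ _ aa (hit a aa)) => //.
by rewrite leeD2l// evalue_le//; exact: admissible_delay.
Qed.

(* v is a viscosity supersolution of |Dv| = l outside M. *)
Lemma running_cost_le_subdifferential z p : closed M -> ~ M z ->
  subdifferential v z p -> l z <= enorm p.
Proof.
move=> Mc Mz pz; apply/ler_addgt0Pr => e e0.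
have {}e0 : 0 < e / 3 by lra.
(* One third each for near-optimality of the control, the variation of [l] near z, and the slack in
   the subdifferential. *)
have -> : e = e / 3 + e / 3 + e / 3 by lra.
set c := e / 3 in e0 *.
have [r r0 Mr] := closed_notin _ _ Mc Mz.
have [d d0 vd] := subdifferential_near _ _ _ _ pz e0.
have /cvgrPdist_lt /(_ _ e0) /(@nbhs_ballP R _) [q /= q0 lq] := l_continuous z.
(* Halving puts h strictly below the radii for avoiding M, for the subdifferential inequality and
   for continuity of [l]. *)
pose h := Num.min (Num.min r d) q / 2.
have hP : [/\ 0 < h, h < r, h < d & h < q].
  by rewrite /h; case: (leP r d) => ?; [case: (leP r q)|case: (leP d q)] => ?; split; lra.
have [h0 hr hd hq] := hP.
have near_z a s : admissible a -> 0 <= s -> enorm (trajectory z a s - z) <= s.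
  move=> aa s0; rewrite -[X in _ - X](trajectory_neg z a 0)// -[leRHS]subr0.
  by apply: trajectory_speed; rewrite ?s0 ?lexx.
have hit a : admissible a -> before_hit M z a h.
  move=> aa; split; first exact: ltW.
  apply: (@lt_le_trans _ _ r%:E); first by rewrite lte_fin.
  apply: le_ereal_inf_tmp => _ [s [s0 Ms] <-]; rewrite lee_fin leNgt.
  by apply/negP => sr; apply: Mr Ms; exact: le_lt_trans (near_z _ _ aa s0) sr.
have ch0 : 0 < c * h by exact: mulr_gt0.
have [a aa va] := value_near_optimal _ _ _ ch0 hit.
have bl := running_cost_bounded_mfun l C l_continuous l_ge0 l_le z a aa.
have h1 : (0 : R) <= 0 <= h by rewrite (ltW h0) andbT.
have lc t : 0 < t <= h -> l z - c <= l (trajectory z a t).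
  move=> /andP[t0 th]; have tq : ball z q (trajectory z a t).
    rewrite -ball_normE /ball_/= distrC (le_lt_trans (norm_le_enorm _))//.
    by rewrite (le_lt_trans (near_z _ _ aa (ltW t0)))// (le_lt_trans th).
  by have := lq _ tq; rewrite ltr_norml; lra.
have := primitive_ge _ _ _ _ bl h1 lc; rewrite primitive0 !subr0 => lh.
set w := trajectory z a h in va.
have wh : enorm (w - z) <= h by exact: near_z _ _ aa (ltW h0).
have := vd w (le_lt_trans wh hd).
have := dotp_le (- p) (w - z); rewrite -scaleN1r dotpZl scaleN1r enormN => pw.
have pwh : enorm p * enorm (w - z) <= enorm p * h.
  by rewrite ler_wpM2l ?enorm_ge0.
have cwh : c * enorm (w - z) <= c * h by rewrite ler_wpM2l ?(ltW e0).
(* With F(h) the running cost: (l(z) - c) h <= F(h) <= v(z) - v(w) + c h <= |p| h + 2 c h. *)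
move=> vw; rewrite -(ler_pM2r h0) !mulrDl; lra.
Qed.

(* Along the inclusion, v(y(s)) - v(y(s - h)) <= - |p| h + o(h): the lower bound
   defining D^- controls v before time s, which is why left differences are
   used. *)
Lemma inclusion_dissipation x a t : closed M -> admissible a ->
  optimal_inclusion M l x a -> before_hit M x a t ->
  primitive (fun s => l (trajectory x a s)) t <= v x.
Proof.
move=> Mc aa inc xt; set y := trajectory x a.
pose F := primitive (fun s => l (y s)).
have bl := running_cost_bounded_mfun l C l_continuous l_ge0 l_le x a aa.
have C0 : 0 <= C by exact: le_trans (l_ge0 x) (l_le x).
have t0 := xt.1.
have y0 : y 0 = x by exact: trajectory_neg.
suff : v (y t) + F t <= v (y 0) + F 0.
  rewrite y0 [F 0]primitive0 addr0; apply: le_trans; rewrite lerDr.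
  exact: (value_ge0 M l C).
apply: (ae_left_nonincreasing (fun s => v (y s) + F s) (C + C)) => //.
- exact: addr_ge0.
- move=> s r sr _.
  have ysr : C * enorm (y r - y s) <= C * (r - s).
    by apply: ler_wpM2l => //; exact: trajectory_speed.
  have v1 := value_lip M l C l_continuous l_ge0 l_le M_nonempty (y r) (y s).
  have v2 := value_lip M l C l_continuous l_ge0 l_le M_nonempty (y s) (y r).
  rewrite enorm_dist_sym in v2.
  have F1 : F r - F s <= C * (r - s) by apply: primitive_le => // q _; exact: l_le.
  have F2 : 0 * (r - s) <= F r - F s by apply: primitive_ge => // q _; exact: l_ge0.
  have CC : 0 <= C * (r - s).
    by case/andP: sr => _ sr; rewrite mulr_ge0// subr_ge0.
  move: v1 v2 F1 F2 ysr CC; rewrite /v; clear.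
  move: (value M l (y r)) (value M l (y s)) (F r) (F s) (enorm _) => v1 v2 F1 F2 q.
  by rewrite mul0r mulrDl; move: (C * (r - s)) (C * q) => c1 c2; lra.
(* Contrapositive: a time at which the decay fails is one at which the inclusion fails. *)
apply: negligibleS inc => s; apply: contra_not => incs /andP[s0 st] e e0.
have xs : before_hit M x a s by apply: before_hitW xt _; rewrite (ltW s0).
have {incs}[p [pz p0 dy]] := incs s0 xs.2.
rewrite -/y in pz dy.
set q := enorm p in dy *.
have q0 : 0 < q.
  rewrite lt_neqAle enorm_ge0 andbT; apply: contra p0 => /eqP/esym/enorm_eq0 ->.
  by [].
have lq : l (y s) <= q.
  by apply: running_cost_le_subdifferential => //; exact: before_hit_notin xs.
(* The errors are q c h from differentiating y, c h from the subdifferential and c h from continuity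
   of [l]: in all (q + 2) c h = e h. *)
set c := e / (q + 2).
have c0 : 0 < c by rewrite divr_gt0//; lra.
have ce : c * (q + 2) = e by rewrite /c divfK//; lra.
have [d d0 vd] := subdifferential_near _ _ _ _ pz c0.
have [d1 d10 ld] : exists2 d1 : R, 0 < d1 &
    forall r, `|s - r| < d1 -> l (y r) <= l (y s) + c.
  have := running_cost_continuous l l_continuous x a aa s.
  move=> /cvgrPdist_lt /(_ _ c0) /(@nbhs_ballP R _) [d1 /= d10 H].
  by exists d1 => // r /H; rewrite /= ltr_norml; lra.
(* Since y has derivative - p / q at s, y(s - h) - y(s) is (h / q) p up to o(h). *)
have [d2 d20 yd] : exists2 d2 : R, 0 < d2 & forall h, 0 < h < d2 ->
    enorm (y (s - h) - y s - (h / q) *: p) <= c * h.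
  (* Pays for the factor n between the norms; the successor keeps the divisor positive when n =
     0. *)
  have c1 : 0 < c / n.+1%:R by rewrite divr_gt0.
  have [dd dE] := dy.
  have : (fun h : R => h^-1 *: ((y \o shift s) (h *: 1) - y s)) @ 0^' --> - (q^-1 *: p).
    by rewrite -dE; exact: dd.
  move=> /cvgrPdist_lt /(_ _ c1) /(@nbhs_ballP R _) [d2 /= d20 H].
  exists d2 => // h /andP[h0 hd2].
  have := H (- h); rewrite -ball_normE /ball_/= sub0r opprK gtr0_norm// => /(_ hd2).
  rewrite oppr_eq0 gt_eqF// => /(_ isT) Hh.
  rewrite (_ : _ - _ = h *: (- (q^-1 *: p) - (- h)^-1 *: (y (- h *: 1 + s) - y s))).
    rewrite enormZ gtr0_norm// mulrC ler_pM2r//.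
    apply: le_trans (enorm_le_norm _) _.
    apply: (@le_trans _ _ (n%:R * (c / n.+1%:R))).
      by rewrite ler_wpM2l// ltW.
    rewrite mulrCA ler_piMr ?(ltW c0)// ler_pdivrMr// mul1r ler_nat.
    exact: leqnSn.
  rewrite /= [- h *: 1]mulr1 [- h + s]addrC invrN scalerBr scalerN scaleNr scalerN.
  rewrite !scalerA divff ?gt_eqF// scale1r opprK.
  by rewrite [RHS]addrC.
exists (Num.min d (Num.min d1 d2)); first by rewrite !lt_min d0 d10.
move=> h /andP[h0]; rewrite !lt_min => /and3P[hd hd1 hd2] hs.
have sh : 0 <= s - h <= s by rewrite subr_ge0 hs lerBlDr lerDl ltW.
have yh : enorm (y (s - h) - y s) <= h.
  by rewrite enorm_dist_sym (le_trans (trajectory_speed _ _ _ _ aa sh))// opprB subrKC.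
have Fh : F s - F (s - h) <= (l (y s) + c) * (s - (s - h)).
  apply: primitive_le => // r rh; apply: ld; case/andP: rh => r1 r2.
  by rewrite ger0_norm ?subr_ge0// (le_lt_trans _ hd1)// lerBlDr -lerBlDl ltW.
have vh := vd _ (le_lt_trans yh hd).
set w := y (s - h) - y s in yd yh vh.
have hw : 0 < h < d2 by rewrite h0.
have {yd} wp := yd _ hw; rewrite -/w in wp.
have pw : h * q - q * (c * h) <= dotp p w.
  have -> : w = (h / q) *: p + (w - (h / q) *: p) by rewrite subrKC.
  rewrite dotpDr dotpZr dotpuu -/q.
  have -> : h / q * q ^+ 2 = h * q by rewrite expr2 mulrA divfK ?gt_eqF.
  have := dotp_le (- p) (w - (h / q) *: p).
  rewrite -scaleN1r dotpZl scaleN1r mulN1r enormN -/q => H.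
  have : q * enorm (w - (h / q) *: p) <= q * (c * h) by rewrite ler_pM2l.
  by rewrite lerD2l lerNl; exact: le_trans H.
have cw : c * enorm w <= c * h by rewrite ler_pM2l.
have lh : l (y s) * h <= q * h by rewrite ler_pM2r.
move: pw vh cw lh Fh; rewrite -ce -/F /v; clear.
move: (value M l (y s)) (value M l (y (s - h))) (F s) (F (s - h)) (l (y s)) => v1 v2 F1 F2 k.
rewrite opprB subrKC; move: (dotp p w) (c * enorm w) => u1 u2; nra.
Qed.

End Dissipation.

(** * Both stability properties from the bound on the running cost *)

Theorem theorem3p5 (R : realType) (n : nat) (M : set 'rV[R]_n)
    (l : 'rV[R]_n -> R)
    (M_nonempty : M !=set0) (M_closed : closed M)
    (l_continuous : continuous l)
    (l_bounded : exists C : R, forall x, `|l x| <= C)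
    (l_pos : forall x, ~ M x -> 0 < l x)
    (l_zero : forall x, M x -> l x = 0)
    (l_away : forall delta : R, 0 < delta -> exists2 gamma : R, 0 < gamma &
       (gamma%:E < ereal_inf [set (l x)%:E | x in [set x | (delta < dist x M)%R]])%E) :
  lyapunov_stable M (optimal_trajectories M l) /\
  globally_asymptotically_stable M (optimal_trajectories M l).
Proof.
have [C lC] := l_bounded.
have l_ge0 x : 0 <= l x.
  by have [Mx|Mx] := pselect (M x); [rewrite l_zero|rewrite ltW// l_pos].
have l_le x : l x <= C by rewrite (le_trans (ler_norm _)).
have C0 : 0 <= C by exact: le_trans (l_ge0 0) (l_le 0).
have budget x a t : admissible a ->
    optimal_cost M l x a \/ optimal_inclusion M l x a -> before_hit M x a t ->
    primitive (fun s => l (trajectory x a s)) t <= value M l x.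
  move=> aa [oc|oi] xt; last exact: (inclusion_dissipation _ _ C).
  rewrite -lee_fin -(evalue_fin M l C)// -oc.
  apply: le_trans (cost_delay_ge _ _ C _ _ _ _ _ _ aa xt) => //.
  by rewrite leeDl// cost_ge0.
(* The convention of staying in M after the hitting time enters here: a position away from M can
   only occur before it. *)
have far x a t e : 0 < e -> 0 <= t ->
    (forall s, 0 <= s -> (hitting_time M x a <= s%:E)%E -> M (trajectory x a s)) ->
    e < dist (trajectory x a t) M -> before_hit M x a t.
  move=> e0 t0 stay ed; split => //; rewrite ltNge; apply/negP => /(stay _ t0)/dist_eq0 d0.
  by move: ed; rewrite d0 ltNge (ltW e0).
(* Being e-far from M at time t costs c, since y has speed at most 1. *)
have toll e : 0 < e -> exists2 c : R, 0 < c & forall x a t, admissible a ->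
    e / 2 <= t -> e < dist (trajectory x a t) M ->
    primitive (fun s => l (trajectory x a s)) (t - e / 2) + c <=
    primitive (fun s => l (trajectory x a s)) t.
  move=> e0; have e20 : 0 < e / 2 by lra.
  (* During [t - e / 2, t] the distance to M exceeds e / 2, so the cost rate is at least g. *)
  have [g g0 gl] := l_away _ e20; exists (g * (e / 2)); first exact: mulr_gt0.
  move=> x a t aa et ed.
  have bl := running_cost_bounded_mfun l C l_continuous l_ge0 l_le x a aa.
  have te : 0 <= t - e / 2 <= t by lra.
  have := primitive_ge _ g _ _ bl te; rewrite subKr -lerBrDl; apply => r /andP[r1 r2].
  have r0 : 0 <= r <= t by lra.
  rewrite -lee_fin (le_trans (ltW gl))//; apply: ereal_inf_lbound.
  exists (trajectory x a r); [rewrite /=|by []].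
  have := dist_lip (trajectory x a t) (trajectory x a r) M M_nonempty.
  have := trajectory_speed x a _ _ aa r0.
  by move: ed; move: (dist _ _) (dist _ _) (enorm _) => d1 d2 d3; lra.
have stable : lyapunov_stable M (optimal_trajectories M l).
  move=> e e0; have [c c0 ec] := toll e e0.
  have C1 : 0 < C + 1 by lra.
  (* The bound e / 4 forces an excursion to distance e to take at least time e / 2; the other one
     gives v(x) <= 2 C eta < c when c > 0. Using C + 1 covers C = 0. *)
  pose eta := Num.min (e / 4) (c / (C + 1) / 2).
  have eta0 : 0 < eta by rewrite lt_min !divr_gt0.
  exists eta => // x xeta _ [a [aa -> opt stay]] t t0.
  rewrite leNgt; apply/negP => ed.
  have xt := far _ _ _ _ e0 t0 stay ed.
  have [z Mz xz] : exists2 z, M z & enorm (x - z) < eta * 2.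
    by apply: dist_lt => //; apply: le_lt_trans xeta _; lra.
  have vc : value M l x < c.
    apply: le_lt_trans (value_target_le M l C l_continuous l_ge0 l_le M_nonempty _ _ Mz) _.
    apply: (@le_lt_trans _ _ (C * (c / (C + 1)))).
      rewrite ler_wpM2l// (le_trans (ltW xz))// -ler_pdivlMr//.
      by rewrite ge_min lexx orbT.
    by rewrite mulrCA gtr_pMr// ltr_pdivrMr//; lra.
  have te : e / 2 <= t.
    have eta4 : eta <= e / 4 by rewrite ge_min lexx.
    have := dist_lip (trajectory x a t) x M M_nonempty.
    have t00 : (0 : R) <= 0 <= t by rewrite lexx.
    have := trajectory_speed x a _ _ aa t00; rewrite (trajectory_neg x a 0)//.
    move: xeta ed; move: (dist _ _) (dist _ _) (enorm _) => d1 d2 d3; lra.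
  have bl := running_cost_bounded_mfun l C l_continuous l_ge0 l_le x a aa.
  have := ec x a t aa te ed; have := budget x a t aa opt xt.
  have : 0 <= primitive (fun s => l (trajectory x a s)) (t - e / 2) by exact: Rintegral_ge0.
  by move: vc; move: (primitive _ _) (primitive _ _) (value _ _ _) => p1 p2 w; lra.
split => //; split => // x _ [a [aa -> opt stay]].
apply/cvgrPdist_le => e e0.
suff [T HT] : exists T, forall t, T <= t -> dist (trajectory x a t) M <= e.
  exists T; split; first exact: num_real.
  move=> t /ltW /HT; rewrite sub0r normrN ger0_norm//; exact: dist_ge0.
apply: contrapT => /forallNP H.
have bl := running_cost_bounded_mfun l C l_continuous l_ge0 l_le x a aa.
have [c c0 ec] := toll e e0.
pose F := primitive (fun s => l (trajectory x a s)).
have unbounded k : exists2 t, before_hit M x a t & c * k%:R <= F t.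
  have later T : 0 <= T -> exists2 t, before_hit M x a t & F T + c <= F t /\ T <= t.
    (* Looking beyond T + e / 2 places the window of the new excursion after T, so its cost adds to
       F(T). *)
    move=> T0; have /existsNP[t /not_implyP[Tt /negP]] := H (T + e / 2).
    rewrite -ltNge => ed; have t0 : 0 <= t by lra.
    exists t; first exact: far ed.
    split; last by lra.
    have et : e / 2 <= t by lra.
    have Te : 0 <= T <= t - e / 2 by lra.
    apply: le_trans (ec x a t aa et ed); rewrite lerD2r -subr_ge0.
    by rewrite -(mul0r (t - e / 2 - T)) primitive_ge.
  elim: k => [|k [t [t0 _] kt]].
    have [t xt _] := later 0 (lexx _); exists t => //.
    by rewrite mulr0; exact: Rintegral_ge0.
  have [t' xt' [tt' _]] := later t t0; exists t' => //.
  by rewrite -natr1 mulrDr mulr1; apply: le_trans tt'; rewrite lerD2r.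
(* More than v(x) / c excursions cost more than v(x). *)
have [t xt kt] := unbounded (Num.bound (value M l x / c)).
have := le_trans kt (budget _ _ _ aa opt xt).
have vc0 : 0 <= value M l x / c.
  by rewrite divr_ge0// ?(ltW c0)//; exact: (value_ge0 M l C).
by have := archi_boundP vc0; rewrite ltr_pdivrMr// mulrC ltNge => /negbTE ->.
Qed.
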